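(* Let $1<p<\infty$, let $C$ be a nonempty bounded closed convex subset of a $p$-uniformly convex Banach space $X$ with the Opial property, and let $c_p>0$ be a constant such that $$\|\lambda x+(1-\lambda)y\|^p\le\lambda\|x\|^p+(1-\lambda)\|y\|^p-c_pW_p(\lambda)\|x-y\|^p$$ for all $x,y\in X$ and $0\le\lambda\le1$, where $W_p(\lambda)=\lambda(1-\lambda)^p+\lambda^p(1-\lambda)$. Let $\mathcal T=\{T_t:t\in G\}$ be an asymptotically regular semigroup on $C$ such that $$\liminf_t|T_t|<\max\left\{(1+c_p)^{1/p},\ \left(\tfrac12\left(1+(1+4c_p\operatorname{WCS}(X)^p)^{1/2}\right)\right)^{1/p}\right\}.$$ Then $\mathcal T$ has a fixed point in $C$ and $\operatorname{Fix}\mathcal T=\{x\in C:T_tx=x,\ t\in G\}$ is a Hölder continuous retract of $C$.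
   Context: A Banach space $X$ is $p$-uniformly convex if $\inf_{\varepsilon>0}\delta(\varepsilon)\varepsilon^{-p}>0$, where $\delta$ is the modulus of uniform convexity of $X$ (with $\varepsilon$ ranging over the domain $(0,2]$ of the modulus). It is known that in a $p$-uniformly convex space a constant $c_p>0$ satisfying the displayed inequality exists. $X$ has the Opial property if $\liminf_{n\to\infty}\|x_n-x\|<\liminf_{n\to\infty}\|x_n-y\|$ for every sequence $(x_n)$ converging weakly to $x$ and every $y\ne x$. $G$ is an unbounded subset of $[0,\infty)$ such that $t+s,\,t-s\in G$ for all $t,s\in G$ with $t>s$. A (nonlinear) semigroup on $C$ is a family $\mathcal T=\{T_t:t\in G\}$ of mappings $T_t:C\to C$ with $T_{t+s}x=T_tT_sx$ for all $t,s\in G$, $x\in C$ (no continuity in $t$ is assumed). It is asymptotically regular if $\lim_t\|T_{t+h}x-T_tx\|=0$ for every $x\in C$ and $h\in G$. Limits and lower limits in $t$ are taken as $t\to\infty$ in $G$. For $T:C\to C$, $|T|=\inf\{k:\|Tx-Ty\|\le k\|x-y\|\ \text{for all } x,y\in C\}$ is the exact Lipschitz constant, with $|T|=\infty$ if $T$ is not Lipschitzian. $\operatorname{WCS}(X)$ is the weakly convergent sequence coefficient: if $X$ does not have the Schur property (the property that every weakly convergent sequence is norm convergent), $\operatorname{WCS}(X)=\sup\{k: k\,r_a(x_n)\le\operatorname{diam}_a(x_n)\ \text{for each weakly null sequence } (x_n) \text{ in } X\}$, where $r_a(x_n)=\inf\{\limsup_n\|x_n-y\|: y\in\overline{\operatorname{conv}}(\{x_n:n\in\mathbb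 N\})\}$ and $\operatorname{diam}_a(x_n)=\inf_n\sup_{i,j\ge n}\|x_i-x_j\|$; if $X$ has the Schur property, $\operatorname{WCS}(X)=2$. A subset $F\subset C$ is a Hölder continuous retract of $C$ if there is a mapping $R:C\to F$ with $Rx=x$ for all $x\in F$ which is Hölder continuous, i.e. $\|Rx-Ry\|\le K\|x-y\|^{\alpha}$ for all $x,y\in C$, for some $K>0$ and $\alpha\in(0,1]$. *)

(* Defs.v *)
From mathcomp Require Import all_boot all_order all_algebra.
From mathcomp Require Import all_classical all_reals all_analysis.

Set Implicit Arguments.
Unset Strict Implicit.
Unset Printing Implicit Defensive.

Import Order.TTheory GRing.Theory Num.Theory.
Import numFieldNormedType.Exports.

Local Open Scope classical_set_scope.
Local Open Scope ring_scope.

Section BanachSpaceGeometry.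
Context {R : realType}.

Section Space.
Variable X : completeNormedModType R.

(* Extended-real infimum: on the zero space the modulus is +oo, the infimum
   of the empty set, rather than the default value 0 of [inf set0]. *)
Definition convexity_modulus (e : R) : \bar R :=
  ereal_inf [set (1 - `|2^-1 *: (z.1 + z.2)|)%:E | z in
    [set z : X * X | [/\ `|z.1| <= 1, `|z.2| <= 1 & e <= `|z.1 - z.2| ]]].

Definition p_uniformly_convex (p : R) : Prop :=
  (0 < ereal_inf [set convexity_modulus e * (e `^ (- p))%:E
                 | e in [set e : R | (0 < e <= 2)%R]])%E.

Definition weakly_cvg (u : nat -> X) (x : X) : Prop :=
  forall f : {linear X -> R^o}, continuous f -> f (u n) @[n --> \oo] --> f x.

Definition Opial_property : Prop :=
  forall (u : nat -> X) (x y : X), weakly_cvg u x -> y <> x ->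
    (limn_einf (fun n => `|u n - x|%:E) < limn_einf (fun n => `|u n - y|%:E))%E.

Definition Schur_property : Prop :=
  forall (u : nat -> X) (x : X), weakly_cvg u x -> cvgn u.

Definition closed_convex_hull (A : set X) : set X :=
  closure (smallest (@convex_set R X) A).

Definition asymptotic_radius (u : nat -> X) : \bar R :=
  ereal_inf [set limn_esup (fun n => `|u n - y|%:E)
            | y in closed_convex_hull (range u)].

Definition asymptotic_diameter (u : nat -> X) : \bar R :=
  ereal_inf (range (fun n : nat =>
    ereal_sup [set `|u z.1 - u z.2|%:E | z in
      [set z : nat * nat | (n <= z.1)%N /\ (n <= z.2)%N]])).

(* The real supremum is legitimate: the set contains 0 and, without the Schur
   property, some weakly null sequence has a positive asymptotic radius and a
   finite asymptotic diameter. *)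
Definition WCS : R :=
  if `[< Schur_property >] then 2
  else sup [set k : R | forall u : nat -> X, weakly_cvg u 0 ->
              (k%:E * asymptotic_radius u <= asymptotic_diameter u)%E].

Definition Wp (p l : R) : R := l * (1 - l) `^ p + l `^ p * (1 - l).

Definition p_convexity_constant (p c : R) : Prop :=
  forall (x y : X) (l : R), 0 <= l <= 1 ->
    `|l *: x + (1 - l) *: y| `^ p
      <= l * `|x| `^ p + (1 - l) * `|y| `^ p - c * Wp p l * `|x - y| `^ p.

(* The restriction 0 <= k matters only when C has at most one point: without
   it the infimum would be -oo there.  The value is +oo if f is not
   Lipschitzian on C. *)
Definition lipschitz_const (C : set X) (f : X -> X) : \bar R :=
  ereal_inf [set k%:E | k in [set k : R | 0 <= k /\ k.-lipschitz_C f]].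

End Space.

Definition semigroup_index (G : set R) : Prop :=
  [/\ ~ bounded_set G,
      forall t, G t -> 0 <= t
    & forall t s, G t -> G s -> s < t -> G (t + s) /\ G (t - s)].

(* The filter "t tends to infinity in G". *)
Definition infty_in (G : set R) : set_system R := within G (nbhs +oo).

Section Semigroups.
Context {X : completeNormedModType R}.

(* A family of self-maps of C is given by total maps X -> X indexed by all
   reals; the values for t outside G or x outside C are irrelevant. *)
Implicit Types (G : set R) (C : set X) (T : R -> X -> X).

Definition semigroup_on G C T : Prop :=
  (forall t x, G t -> C x -> C (T t x)) /\
  (forall t s x, G t -> G s -> C x -> T (t + s) x = T t (T s x)).

Definition asymptotically_regular G C T : Prop :=
  forall x h, C x -> G h -> `|T (t + h) x - T t x| @[t --> infty_in G] --> 0.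

Definition Fix G C T : set X := [set x | C x /\ forall t, G t -> T t x = x].

Definition Holder_retract C (F : set X) : Prop :=
  F `<=` C /\
  exists r : X -> X,
    [/\ forall x, C x -> F (r x),
        forall x, F x -> r x = x
      & exists K alpha : R, [/\ 0 < K, 0 < alpha <= 1
          & forall x y, C x -> C y -> `|r x - r y| <= K * `|x - y| `^ alpha]].

End Semigroups.

End BanachSpaceGeometry.

(* Main.v *)
(* Fix k below the bound and t_n -> oo in G such that every T_(t_n) is
   k-Lipschitz, and an ultrafilter U on nat finer than \oo.  Let A x be the weak
   limit of T_(t_n) x along U; it exists by uniform convexity, and A is
   k-Lipschitz because weak limits are linear and the norm is weakly lower
   semicontinuous (asymptotic centers would only yield Hoelder continuity, which
   degenerates under iteration).  Weakly convergent sequences can be extracted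
   from U, so the Opial property shows that z = A x minimises
   r(y) = lim_U |T_(t_n) x - y|, with r(z)^p + c |z - y|^p <= r(y)^p.  Taking
   y = T_(t_m) z, where r(T_(t_m) z) <= k r(z) by asymptotic regularity, gives
   c d(A x)^p <= (k^p - 1) r(z)^p for d(x) = lim_U |T_(t_n) x - x|.  Now
   r(z) <= d(x) by minimality, and w r(z) <= k d(x) for every 0 < w < WCS(X), so in
   either case of the hypothesis d(A x) <= g d(x) with g < 1.  As |A x - x| <= d(x),
   the iterates of A converge geometrically to points with d = 0, which are the
   fixed points of T; interpolating the geometric rate g^n with the Lipschitz
   constants of A^n shows that the limit map is Hoelder continuous. *)

From HB Require Import structures.
Require Import Defs.
From mathcomp Require Import all_boot all_order all_algebra.
From mathcomp Require Import all_classical all_reals all_analysis.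
From mathcomp Require Import ring lra.
Import Order.TTheory GRing.Theory Num.Theory.
Import numFieldNormedType.Exports.
Local Open Scope classical_set_scope.
Local Open Scope ring_scope.

(** * Norming functionals *)

Section NormingFunctional.
Context {R : realType} {X : normedModType R}.
Implicit Types (q : X -> R) (x y : X).

(** Homogeneity is asked only as an inequality for [0 < t], which passes easily to infima; equality
    follows by applying it to [t^-1] as well. *)
Definition norm_sublinear q : Prop :=
  [/\ forall x y, q (x + y) <= q x + q y,
      forall (t : R) x, 0 < t -> q (t *: x) <= t * q x
    & forall x, q x <= `|x|].

Lemma norm_sublinear_norm : norm_sublinear (fun x => `|x|).
Proof.
split=> [x y|t x t0|x] //; first exact: ler_normD.
by rewrite normrZ gtr0_norm.
Qed.

Lemma norm_sublinear0 q : norm_sublinear q -> q 0 = 0.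
Proof.
move=> [_ qZ qn]; apply/eqP; rewrite eq_le; apply/andP; split.
  by rewrite (le_trans (qn 0)) ?normr0.
by have := qZ 2 0 (ltr0Sn _ _); rewrite scaler0; lra.
Qed.

Lemma norm_sublinearZ q (t : R) x :
  norm_sublinear q -> 0 <= t -> q (t *: x) = t * q x.
Proof.
move=> sq; rewrite le_eqVlt => /orP[/eqP <-|t0].
  by rewrite scale0r mul0r norm_sublinear0.
have [_ qZ _] := sq; apply/eqP; rewrite eq_le qZ//=.
have := qZ t^-1 (t *: x); rewrite invr_gt0 => /(_ t0).
by rewrite scalerK ?gt_eqF// mulrC ler_pdivlMr// mulrC.
Qed.

Lemma norm_sublinear_oppr q x : norm_sublinear q -> - q (- x) <= q x.
Proof.
move=> sq; have [qD _ _] := sq; have := qD x (- x).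
by rewrite subrr norm_sublinear0//; lra.
Qed.

Lemma norm_sublinear_lb q x : norm_sublinear q -> - `|x| <= q x.
Proof.
move=> sq; have [_ _ qn] := sq; apply: le_trans (norm_sublinear_oppr q x sq).
by rewrite lerN2 (le_trans (qn _))// normrN.
Qed.

(** The third hypothesis is the form of directedness that subadditivity needs; a chain satisfies it
    with the smaller of [q1] and [q2]. The common lower bound, minus the norm, keeps the infima
    finite. *)
Lemma norm_sublinear_inf (A : set (X -> R)) :
  A !=set0 -> (forall q, A q -> norm_sublinear q) ->
  (forall q1 q2 x y, A q1 -> A q2 -> exists2 q, A q & q (x + y) <= q1 x + q2 y) ->
  norm_sublinear (fun x => inf [set q x | q in A]).
Proof.
move=> A0 sA dA.
have n0 x : [set q x | q in A] !=set0 by case: A0 => q Aq; exists (q x), q.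
have lbA x : has_lbound [set q x | q in A].
  by exists (- `|x|) => _ [q Aq <-]; exact: norm_sublinear_lb (sA _ Aq).
have le q x : A q -> inf [set q x | q in A] <= q x.
  by move=> Aq; apply: ge_inf => //; exists q.
split=> [x y|t x t0|x].
- rewrite -lerBlDr; apply: lb_le_inf => // _ [q1 A1 <-].
  rewrite lerBlDl -lerBlDr; apply: lb_le_inf => // _ [q2 A2 <-].
  have [q Aq qxy] := dA _ _ x y A1 A2.
  by rewrite lerBlDl (le_trans (le _ _ Aq)).
- rewrite -ler_pdivrMl//; apply: lb_le_inf => // _ [q Aq <-].
  rewrite ler_pdivrMl// (le_trans (le _ _ Aq))//.
  by have [_ qZ _] := sA _ Aq; exact: qZ.
- case: A0 => q Aq; apply: le_trans (le _ _ Aq) _.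
  by have [_ _] := sA _ Aq; apply.
Qed.

(** Take the infimum of [q (x + t *: y) - t * q y] over [0 <= t]: subadditivity bounds it below by
    [- q (- x)], and the choices [t = 0] and [t = 1] give the two inequalities. *)
Lemma norm_sublinear_shift q y : norm_sublinear q ->
  exists q', [/\ norm_sublinear q', forall x, q' x <= q x & q' (- y) <= - q y].
Proof.
move=> sq; have [qD qZ qn] := sq.
pose V x := [set q (x + t *: y) - t * q y | t in [set t : R | 0 <= t]].
pose q' x := inf (V x).
have V0 x : V x !=set0 by exists (q (x + 0 *: y) - 0 * q y), 0 => /=.
have lbV x : lbound (V x) (- q (- x)).
  move=> _ [t /= t0 <-]; rewrite -(norm_sublinearZ q t y sq t0).
  by have := qD (x + t *: y) (- x); rewrite addrAC subrr add0r; lra.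
have hV x : has_lbound (V x) by exists (- q (- x)).
have le x (t : R) : 0 <= t -> q' x <= q (x + t *: y) - t * q y.
  by move=> t0; apply: ge_inf => //; exists t.
have q'q x : q' x <= q x by have := le x 0 (lexx _); rewrite scale0r addr0 mul0r subr0.
exists q'; split => //; last first.
  by have := le (- y) 1 ler01; rewrite scale1r addNr norm_sublinear0// mul1r sub0r.
split=> [x1 x2|t x t0|x]; last exact: le_trans (qn x).
- rewrite -lerBlDr; apply: lb_le_inf => // _ [t1 /= t10 <-].
  rewrite lerBlDl -lerBlDr; apply: lb_le_inf => // _ [t2 /= t20 <-].
  have := le (x1 + x2) (t1 + t2) (addr_ge0 t10 t20).
  have := qD (x1 + t1 *: y) (x2 + t2 *: y).
  by rewrite scalerDl addrACA mulrDl; lra.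
- rewrite -ler_pdivrMl//; apply: lb_le_inf => // _ [s /= s0 <-].
  rewrite ler_pdivrMl//; have := le (t *: x) (t * s) (mulr_ge0 (ltW t0) s0).
  rewrite -scalerA -scalerDr mulrBr mulrA => /le_trans; apply.
  by rewrite lerD2r qZ.
Qed.

(* A minimal sublinear functional below a given one exists by Zorn's lemma, and
   minimality with respect to [norm_sublinear_shift] forces it to be odd, hence
   linear; starting from the norm shifted along x0 makes it norm x0. *)
Lemma norming_functional x0 :
  exists f : {linear X -> R^o},
    [/\ continuous f, forall x, `|f x| <= `|x| & f x0 = `|x0|].
Proof.
have [q0 [sq0 _ q0x]] := norm_sublinear_shift _ x0 norm_sublinear_norm.
pose T := {q : X -> R | norm_sublinear q /\ forall x, q x <= q0 x}.
(* The order is reversed, so that a maximal element is a minimal functional. *)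
pose Rel (a b : T) := `[< forall x, sval b x <= sval a x >].
have [||A Atot|[q [sq qq0]] qmin] := @ZL_preorder T
    (exist _ q0 (conj sq0 (fun x => lexx (q0 x)))) Rel.
- by move=> a; apply/asboolP.
- move=> a b c /asboolP ab /asboolP bc; apply/asboolP => x.
  exact: le_trans (bc x) (ab x).
- have [[a0 Aa0]|A0] := pselect (A !=set0); last first.
    by exists (exist _ q0 (conj sq0 (fun x => lexx (q0 x)))) => s As; case: A0; exists s.
  pose B : set (X -> R) := [set sval a | a in A].
  have sB q : B q -> norm_sublinear q by move=> [a _ <-]; case: (svalP a).
  have sinf : norm_sublinear (fun x => inf [set q x | q in B]).
    apply: norm_sublinear_inf => //; first by exists (sval a0), a0.
    move=> _ _ x y [a Aa <-] [b Ab <-].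
    have [[aD _ _] _] := svalP a; have [[bD _ _] _] := svalP b.
    have [/asboolP ab|/asboolP ba] := Atot _ _ Aa Ab.
      by exists (sval b); [exists b|rewrite (le_trans (bD _ _))// lerD2r].
    by exists (sval a); [exists a|rewrite (le_trans (aD _ _))// lerD2l].
  have le a x : A a -> inf [set q x | q in B] <= sval a x.
    move=> Aa; apply: ge_inf; last by exists (sval a) => //; exists a.
    by exists (- `|x|) => _ [q Bq <-]; exact: norm_sublinear_lb (sB _ Bq).
  have leq0 x : inf [set q x | q in B] <= q0 x.
    by apply: le_trans (le a0 x Aa0) _; have [_] := svalP a0; apply.
  exists (exist _ (fun x => inf [set q x | q in B]) (conj sinf leq0)) => a Aa.
  apply/asboolP => x /=.
  exact: le.
have [qD qZ qn] := sq.
have qN x : q (- x) = - q x.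
  have [q' [sq' q'q q'x]] := norm_sublinear_shift _ x sq.
  have q'0 z : q' z <= q0 z by exact: le_trans (qq0 z).
  have : Rel (exist _ q (conj sq qq0)) (exist _ q' (conj sq' q'0)).
    by apply/asboolP.
  move=> /qmin /asboolP /= /(_ (- x)) qq'.
  apply/eqP; rewrite eq_le (le_trans qq')//=.
  by have := norm_sublinear_oppr q x sq; lra.
have qDE x y : q (x + y) = q x + q y.
  apply/eqP; rewrite eq_le qD/=.
  by have := qD (x + y) (- y); rewrite addrK qN; lra.
have qZE (t : R) x : q (t *: x) = t * q x.
  have [t0|t0] := leP 0 t; first exact: norm_sublinearZ.
  rewrite -[t]opprK scaleNr qN norm_sublinearZ ?mulNr// oppr_ge0; exact: ltW.
have qlin : linear (q : X -> R^o) by move=> t x y; rewrite qDE qZE.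
pose f : {linear X -> R^o} := HB.pack (q : X -> R^o) (GRing.isLinear.Build R X R^o _ _ qlin).
have fE x : f x = q x by [].
have fn x : `|f x| <= `|x|.
  by rewrite fE ler_norml norm_sublinear_lb//=.
exists f; split => //.
- apply: bounded_linear_continuous; apply/bounded_funP => r.
  by exists r => x; exact: le_trans.
- apply/eqP; rewrite fE eq_le qn/=.
  have := qq0 (- x0); rewrite qN => /le_trans /(_ q0x); rewrite lerN2.
  exact.
Qed.

End NormingFunctional.

(** * Weak limits along filters *)

Section ConvexSets.
Context {R : realType} {X : lmodType R}.

Lemma convex_setP (K : set (convex_lmodType X)) : convex_set K <->
  forall (x y : X) (l : R), 0 <= l <= 1 -> K x -> K y -> K (l *: x + (1 - l) *: y).
Proof.
split=> [cK x y l /andP[l0 l1] Kx Ky|cK x y l /set_mem Kx /set_mem Ky].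
  by have := cK x y (Itv01 l0 l1) (mem_set Kx) (mem_set Ky); rewrite inE.
by apply/mem_set; apply: (cK x y l%:num) => //; rewrite ge0 le1.
Qed.

End ConvexSets.

Section WeakLimit.
Context {R : realType} {X : completeNormedModType R} {I : Type}.
Implicit Types (F : set_system I) (u : I -> X) (x y z : X).

(* The weak limit along a filter, expressed through closed convex sets rather
   than functionals. *)
Definition weak_limit F u z : Prop :=
  forall K : set X, closed K -> convex_set K -> F (u @^-1` K) -> K z.

(* Almost minimal norm points of the closed convex sets containing F-almost
   all u i form a Cauchy filter, by uniform convexity at the midpoint. *)
Lemma weak_limit_exists (p c M : R) F u : 1 < p -> 0 < c ->
  p_convexity_constant X p c -> ProperFilter F -> (forall i, `|u i| <= M) ->
  exists z, weak_limit F u z.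
Proof.
move=> p1 c0 pc FF uM; have p0 : 0 < p by exact: lt_trans ltr01 p1.
pose h x := `|x| `^ p.
pose w := c * Wp p 2^-1.
have w0 : 0 < w.
  rewrite mulr_gt0// /Wp addr_gt0// mulr_gt0 ?powR_gt0//; lra.
have hmid x y : h (2^-1 *: x + (1 - 2^-1) *: y) <=
    2^-1 * h x + (1 - 2^-1) * h y - w * `|x - y| `^ p.
  by apply: pc; lra.
pose KK K := [/\ closed K, convex_set K & F (u @^-1` K)].
have KT : KK setT.
  by split; [exact: closedT|apply/convex_setP|exact: filterT].
have KI A B : KK A -> KK B -> KK (A `&` B).
  move=> [cA /convex_setP vA FA] [cB /convex_setP vB FB]; split.
  - exact: closedI.
  - by apply/convex_setP => x y l l01 [Ax Bx] [Ay By]; split; [exact: vA|exact: vB].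
  - exact: (filterI FA FB).
pose m K := inf (h @` K).
have lbh K : has_lbound (h @` K) by exists 0 => _ [x _ <-]; exact: powR_ge0.
have h0 K : KK K -> has_inf (h @` K).
  by move=> [_ _ /filter_ex[i Ki]]; split=> //; exists (h (u i)), (u i).
have hM K : KK K -> m K <= M `^ p.
  move=> [_ _ /filter_ex[i Ki]]; apply: (@le_trans _ _ (h (u i))).
    by apply: ge_inf => //; exists (u i).
  by apply: ge0_ler_powR => //; rewrite ?nnegrE ?(le_trans _ (uM i))// ltW.
have supm : has_sup (m @` KK).
  by split; [exists (m setT), setT|exists (M `^ p) => _ [K /hM KM <-]].
(* Every [m K] is at most [S], so each [K] has points with [h x < S + e]; these nonempty sets form
   the filter base. *)
pose S := sup (m @` KK).
have mS K : KK K -> m K <= S by move=> kK; apply: ub_le_sup; [case: supm|exists K].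
pose D := [set eK : R * set X | 0 < eK.1 /\ KK eK.2].
pose N (eK : R * set X) := eK.2 `&` [set x | h x < S + eK.1].
have GF : Filter (filter_from D N).
  apply: filter_from_filter; first by exists (1, setT); split => //=.
  move=> [e A] [e' B] [/= e0 kA] [/= e'0 kB]; exists (Num.min e e', A `&` B).
    by split => /=; [rewrite lt_min e0|exact: KI].
  move=> x [[/= Ax Bx] xm]; split; split => //=; apply: (lt_le_trans xm);
    by rewrite lerD2l ge_min lexx ?orbT.
have GP : ProperFilter (filter_from D N).
  apply: filter_from_proper => -[e K] [/= e0 kK].
  have [_ [x Kx <-] hx] := inf_adherent e0 (h0 K kK).
  by exists x; split => //=; apply: (lt_le_trans hx); rewrite lerD2r mS.
have Gc : cauchy (filter_from D N).
  (* With this [d], two points of [K] with [h < S + d] at distance at least [e] would have a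
     midpoint with [h < S + d - 2 * d < m K]. *)
  apply: cauchy_exP => e e0; pose d := w * e `^ p / 2.
  have d0 : 0 < d by rewrite divr_gt0// mulr_gt0// powR_gt0.
  have [_ [K kK <-] mK] := sup_adherent d0 supm.
  have [_ [x Kx <-] hx] := inf_adherent d0 (h0 K kK).
  have {}hx : h x < S + d by apply: (lt_le_trans hx); rewrite lerD2r mS.
  exists x; exists (d, K) => // y [/= Ky hy].
  rewrite -ball_normE /=; rewrite ltNge; apply/negP => exy.
  have exyp : e `^ p <= `|x - y| `^ p.
    by apply: ge0_ler_powR; rewrite ?nnegrE ?(ltW e0) ?(ltW p0).
  have : m K <= h (2^-1 *: x + (1 - 2^-1) *: y).
    apply: ge_inf => //; exists (2^-1 *: x + (1 - 2^-1) *: y) => //.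
    by have [_ /convex_setP cK _] := kK; apply: cK => //; lra.
  move: (hmid x y) (ler_wpM2l (ltW w0) exyp); rewrite -/S in mK.
  have : w * e `^ p = 2 * d by rewrite /d; field.
  lra.
have Gz : cvg (filter_from D N) by exact: cauchy_cvg.
exists (lim (filter_from D N)) => K clK cvK FK.
apply: (@closed_cvg _ _ _ GP id K clK _ _ Gz).
by exists (1, K) => //= x [].
Qed.

Lemma weak_limit_closed_ball F u z y (r : R) :
  weak_limit F u z -> (\forall i \near F, `|u i - y| <= r) -> `|z - y| <= r.
Proof.
move=> uz Fr; apply: (uz [set x | `|x - y| <= r]) => //.
- apply: (@closed_comp _ _ (fun x => `|x - y|) [set t | t <= r]).
    move=> x _; apply: (@continuous_comp _ _ _ (fun x => x - y) Num.norm).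
      by apply: cvgB; [exact: cvg_id|exact: cvg_cst].
    exact: norm_continuous.
  exact: closed_le.
- apply/convex_setP => x1 x2 l /andP[l0 l1] /= h1 h2.
  rewrite [X in `|X|](_ : _ = l *: (x1 - y) + (1 - l) *: (x2 - y)); last first.
    by rewrite !scalerBr addrACA -opprD -scalerDl [l + _]addrC subrK scale1r.
  rewrite (le_trans (ler_normD _ _))// !normrZ !ger0_norm ?subr_ge0//.
  have : l * `|x1 - y| <= l * r by rewrite ler_wpM2l.
  have : (1 - l) * `|x2 - y| <= (1 - l) * r by rewrite ler_wpM2l// subr_ge0.
  lra.
Qed.

(** The slabs on which [f] differs from [a] by at most [e] are closed and convex, so they can be
    tested in [weak_limit]. *)
Lemma weak_limit_functional F u z (f : {linear X -> R^o}) (a : R) :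
  ProperFilter F -> continuous f -> weak_limit F u z ->
  f (u i) @[i --> F] --> a -> f z = a.
Proof.
move=> FF cf uz fa.
suff fze e : 0 < e -> `|f z - a| <= e.
  apply/eqP; rewrite -subr_eq0 -normr_le0; apply/ler_addgt0Pr => e e0.
  by rewrite add0r fze.
move=> e0; apply: (uz [set x | `|f x - a| <= e]).
- apply: (@closed_comp _ _ (fun x => `|f x - a|) [set t : R | t <= e]).
    move=> x _; apply: (@continuous_comp _ _ _ (fun x => f x - a) Num.norm).
      by apply: (@cvgB _ R^o); [exact: cf|exact: cvg_cst].
    exact: norm_continuous.
  exact: closed_le.
- apply/convex_setP => x y l /andP[l0 l1] /= fx fy.
  rewrite linearD !linearZ /= [X in `|X|](_ : _ = l * (f x - a) + (1 - l) * (f y - a)).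
    rewrite (le_trans (ler_normD _ _))// !normrM (ger0_norm l0) (@ger0_norm _ (1 - l)) ?subr_ge0//.
    have : l * `|f x - a| <= l * e by rewrite ler_wpM2l.
    have : (1 - l) * `|f y - a| <= (1 - l) * e by rewrite ler_wpM2l// subr_ge0.
    lra.
  rewrite /GRing.scale /=; ring.
- exact: (cvgr_distC_le _ _ fa e e0).
Qed.

End WeakLimit.

(** Compactness of the segment gives a cluster point, and an ultrafilter converges to its cluster
    points. *)
Lemma ultra_bounded_cvg (R : realType) (I : Type) (U : set_system I) (f : I -> R) (M : R) :
  UltraFilter U -> (forall i, `|f i| <= M) -> cvg (f i @[i --> U]).
Proof.
move=> UU fM.
have fUM : U (f @^-1` `[- M, M]%classic).
  by apply: filterE => i /=; rewrite in_itv /= -ler_norml; exact: fM.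
have [l [_ cl]] := @segment_compact R (- M) M (f i @[i --> U]) _ fUM.
apply/cvg_ex; exists l => B Bl.
have [//|UB] := in_ultra_setVsetC (f @^-1` B) UU.
by have [x [nBx Bx]] := cl (~` B) B UB Bl; case: (nBx Bx).
Qed.

(** * Rational combinations and the closed span of a sequence *)

Section CountableDense.
Context {R : realType} {X : normedModType R}.
Implicit Types (u : nat -> X) (P : {poly rat}).

(** Polynomials over [rat] serve as finitely supported coefficient sequences: they form a countable
    type, so the combinations can be enumerated by [unpickle]. *)
Definition rat_comb u P : X := \sum_(i < size P) ratr P`_i *: u i.

Lemma rat_combE u P n : (size P <= n)%N ->
  rat_comb u P = \sum_(i < n) ratr P`_i *: u i.
Proof.
move=> Pn; rewrite /rat_comb -!(big_mkord xpredT (fun i => ratr P`_i *: u i)).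
rewrite [RHS](@big_cat_nat _ _ _ (size P)) //= [X in _ + X]big1_seq ?addr0// => i.
rewrite mem_index_iota => /andP[_ /andP[Pi _]].
by rewrite nth_default// rmorph0 scale0r.
Qed.

Lemma rat_combD u P Q : rat_comb u (P + Q) = rat_comb u P + rat_comb u Q.
Proof.
pose n := maxn (size P) (size Q).
rewrite !(rat_combE u _ n) ?leq_maxl ?leq_maxr ?size_polyD// -big_split/=.
by apply: eq_bigr => i _; rewrite coefD rmorphD scalerDl.
Qed.

Lemma rat_combZ u (a : rat) P : rat_comb u (a *: P) = ratr a *: rat_comb u P.
Proof.
rewrite !(rat_combE u _ (size P)) ?size_scale_leq// scaler_sumr.
by apply: eq_bigr => i _; rewrite coefZ rmorphM scalerA.
Qed.

Lemma rat_combX u n : rat_comb u 'X^n = u n.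
Proof.
rewrite /rat_comb size_polyXn big_ord_recr/= coefXn eqxx rmorph1 scale1r.
rewrite big1 ?add0r// => i _; rewrite coefXn ltn_eqF// rmorph0 scale0r//.
Qed.

Definition rat_span u : set X := closure (range (rat_comb u)).

Lemma rat_spanP u x :
  rat_span u x <-> forall e : R, 0 < e -> exists P, `|x - rat_comb u P| < e.
Proof.
split=> [ux e e0|ux B /nbhs_ballP[e /= e0 eB]].
  have [_ [[P _ <-]]] := ux _ (nbhsx_ballx x _ e0).
  by rewrite -ball_normE /=; exists P.
have [P xP] := ux e e0; exists (rat_comb u P); split; first by exists P.
by apply: eB; rewrite -ball_normE.
Qed.

Lemma rat_span_gen u n : rat_span u (u n).
Proof. by apply/rat_spanP => e e0; exists 'X^n; rewrite rat_combX subrr normr0. Qed.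

Lemma rat_spanD u x y : rat_span u x -> rat_span u y -> rat_span u (x + y).
Proof.
move=> /rat_spanP ux /rat_spanP uy; apply/rat_spanP => e e0.
have e20 : 0 < e / 2 by rewrite divr_gt0.
have [P xP] := ux _ e20; have [Q yQ] := uy _ e20; exists (P + Q).
rewrite rat_combD opprD addrACA (le_lt_trans (ler_normD _ _))//; lra.
Qed.

(** The combination near [x] is chosen first, because the error made in replacing [a] by a rational
    is multiplied by the norm of that combination. *)
Lemma rat_spanZ u (a : R) x : rat_span u x -> rat_span u (a *: x).
Proof.
move=> /rat_spanP ux; apply/rat_spanP => e e0.
have a1 : 0 < `|a| + 1 by rewrite ltr_wpDl.
have d0 : 0 < e / 2 / (`|a| + 1) by rewrite !divr_gt0.
have [P xP] := ux _ d0.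
have P1 : 0 < `|rat_comb u P| + 1 by rewrite ltr_wpDl.
have t0 : 0 < e / 2 / (`|rat_comb u P| + 1) by rewrite !divr_gt0.
have [q] : exists q : rat, `|a - ratr q| < e / 2 / (`|rat_comb u P| + 1).
  have [q] := @rat_in_itvoo R a (a + e / 2 / (`|rat_comb u P| + 1)) ltac:(by rewrite ltrDl).
  rewrite in_itv/= => /andP[aq qa]; exists q; rewrite ltr_norml; lra.
rewrite ltr_pdivlMr// => aq; exists (q *: P); rewrite rat_combZ.
have -> : a *: x - ratr q *: rat_comb u P =
    a *: (x - rat_comb u P) + (a - ratr q) *: rat_comb u P.
  by rewrite scalerBr scalerBl addrA subrK.
rewrite (le_lt_trans (ler_normD _ _))// !normrZ.
move: xP; rewrite ltr_pdivlMr// => xP.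
have := normr_ge0 (x - rat_comb u P); have := normr_ge0 (a - ratr q).
nra.
Qed.

Lemma rat_span_convex u : convex_set (rat_span u : set (convex_lmodType X)).
Proof.
by apply/convex_setP => x y l _ ux uy; apply: rat_spanD; exact: rat_spanZ.
Qed.

End CountableDense.

(** * Weakly convergent subsequences *)
(** If the preimage of a neighbourhood of [l] were not in [F], its complement together with [F]
    would generate a proper filter, and an ultrafilter above it would contradict the hypothesis. *)
Lemma cvg_ultra (I : Type) (T : topologicalType) (F : set_system I) (g : I -> T) (l : T) :
  Filter F ->
  (forall V, UltraFilter V -> F `<=` V -> g i @[i --> V] --> l) ->
  g i @[i --> F] --> l.
Proof.
move=> FF gV A Al; suff : F (g @^-1` A) by [].
apply: contrapT => nFA.
have PF : ProperFilter (within (~` (g @^-1` A)) F).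
  apply: Build_ProperFilter_ex => S FS; apply: contrapT => S0; apply: nFA.
  apply: (@filterS _ F _ _ _ _ (FS : F _)) => i SiA; apply: contrapT => nA; apply: S0.
  by exists i; apply: SiA.
have [V [UV FV]] := ultraFilterLemma PF.
have VA : V (g @^-1` A).
  by apply: (gV V UV _ A Al) => B FB; apply: FV; apply: filterS FB => i Bi.
have VnA : V (~` (g @^-1` A)) by apply: FV; exact: withinT.
by have /filter_ex[i [Ai nAi]] : V (g @^-1` A `&` ~` (g @^-1` A)) by exact: filterI.
Qed.

Lemma cvg_harmonic_dist (R : realType) (v : nat -> R) (a : R) :
  (forall k, `|v k - a| < k.+1%:R^-1) -> v k @[k --> \oo] --> a.
Proof.
move=> va; apply/cvgrPdist_lt => e e0; near=> k.
rewrite distrC (lt_trans (va k))//.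
by near: k; exact: near_infty_natSinv_lt (PosNum e0).
Unshelve. all: by end_near. Qed.

Section Subsequences.
Context {R : realType} {X : completeNormedModType R} (p c : R).
Hypotheses (p1 : 1 < p) (c0 : 0 < c) (pc : p_convexity_constant X p c).

(* The functionals norming the rational combinations of the u n are countably
   many and separate the points of the span, hence convergence of all of them
   along a subsequence forces weak convergence. *)
Lemma weakly_cvg_subsequence (U : set_system nat) (u : nat -> X) (M : R) (z : X)
    (Q : seq nat -> nat -> Prop) :
  UltraFilter U -> (forall n, `|u n| <= M) -> weak_limit U u z ->
  (forall s, U [set n | Q s n]) ->
  exists phi : nat -> nat,
    weakly_cvg (u \o phi) z /\ forall k, Q (mkseq phi k) (phi k).
Proof.
move=> UU uM uz UQ.
have [fd fdP] := choice (fun P => norming_functional (rat_comb u P)).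
have fdz P : fd P (u n) @[n --> U] --> fd P z.
  have [fc fn _] := fdP P.
  have fu : cvg (fd P (u n) @[n --> U]).
    by apply: (@ultra_bounded_cvg R _ _ _ M) => n; exact: le_trans (fn _) (uM n).
  by rewrite (weak_limit_functional _ _ _ _ _ _ fc uz fu).
(* Here [s] lists the indices chosen so far. Its length is the stage: it says how many functionals
   are controlled and how closely. Codes of no polynomial default to the polynomial 0. *)
pose near_z (s : seq nat) := [set n | forall i : 'I_(size s),
  let f := fd (odflt 0 (unpickle i)) in `|f (u n) - f z| < (size s).+1%:R^-1].
have ch s : {n | Q s n /\ near_z s n}.
  apply: cid; apply: (@filter_ex _ U); apply: filterI; first exact: UQ.
  apply: filter_forall => i.
  exact: (cvgr_distC_lt _ _ (fdz _)).
pose fix lst k := if k is k'.+1 then rcons (lst k') (sval (ch (lst k'))) else [::].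
pose phi k := sval (ch (lst k)).
have lstE k : lst k = mkseq phi k by elim: k => // k IH; rewrite mkseqS -IH.
exists phi; split; last by move=> k; rewrite -lstE; case: (svalP (ch (lst k))).
have phiz P : fd P (u (phi k)) @[k --> \oo] --> fd P z.
  (* The functional of [P] is controlled only once the stage exceeds [pickle P]. *)
  rewrite -(cvg_shiftn (pickle P).+1); apply: cvg_harmonic_dist => k.
  have [_] := svalP (ch (lst (k + (pickle P).+1)%N)); rewrite /near_z /=.
  have szl : size (lst (k + (pickle P).+1)%N) = (k + (pickle P).+1)%N.
    by rewrite lstE size_mkseq.
  have Pl : (pickle P < size (lst (k + (pickle P).+1)%N))%N by rewrite szl addnS ltnS leq_addl.
  move=> /(_ (Ordinal Pl)); rewrite /= pickleK /= => /lt_trans; apply.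
  by rewrite szl ltf_pV2 ?posrE// ltr_nat ltnS addnS ltnS leq_addr.
(* Along an ultrafilter finer than [\oo] the extracted sequence has some weak limit [w]; it suffices
   that [w = z]. *)
move=> f fc; apply: cvg_ultra => V UV ooV.
have [w uw] : exists w, weak_limit V (u \o phi) w.
  by apply: (weak_limit_exists p c M) => // k; exact: uM.
have [B fB] : exists B, forall x, `|x| <= M -> `|f x| <= B.
  by have /bounded_funP := continuous_linear_bounded 0 (fc 0); apply.
have fw : cvg (f (u (phi k)) @[k --> V]).
  by apply: (@ultra_bounded_cvg R _ _ _ B) => k; apply: fB.
rewrite -[z](_ : w = z); first by rewrite (weak_limit_functional _ _ _ _ _ _ fc uw fw).
have spanz : rat_span u z.
  apply: uz; [exact: closed_closure|exact: rat_span_convex|].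
  by apply: filterE => n; exact: rat_span_gen.
have spanw : rat_span u w.
  apply: uw; [exact: closed_closure|exact: rat_span_convex|].
  by apply: filterE => n; exact: rat_span_gen.
have /rat_spanP spanwz := rat_spanD _ _ _ spanw (rat_spanZ _ (-1) _ spanz).
(* A functional norming a rational combination near [w - z] vanishes at [w - z]; so the combination
   is small, and with it [w - z]. *)
apply/eqP; rewrite -subr_eq0 -normr_le0; apply/ler_addgt0Pr => e e0.
have e20 : 0 < e / 2 by rewrite divr_gt0.
have [P] := spanwz _ e20.
rewrite scaleN1r add0r => wzP.
have [Pc Pn PP] := fdP P.
have wzE : fd P w = fd P z.
  by apply: (weak_limit_functional _ _ _ _ _ _ Pc uw) => A /phiz; exact: ooV.
have : `|rat_comb u P| <= `|w - z - rat_comb u P|.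
  rewrite -PP -[_ - rat_comb u P]opprK normrN (le_trans _ (Pn _))//.
  by rewrite opprB linearB [fd P (w - z)]linearB wzE subrr subr0 ler_norm.
have := ler_normD (w - z - rat_comb u P) (rat_comb u P); rewrite subrK.
lra.
Qed.

End Subsequences.

(** * Asymptotic centers *)
(** Continuity is taken from derivability, available only at positive points; the limit 0 is treated
    by hand. *)
Lemma powR_cvg (R : realType) (I : Type) (F : set_system I) (f : I -> R) (a p : R) :
  ProperFilter F -> 0 < p -> (forall i, 0 <= f i) ->
  f i @[i --> F] --> a -> f i `^ p @[i --> F] --> a `^ p.
Proof.
move=> FF p0 f0 fa; have [a0|a0] := ltP 0 a.
  apply: (@continuous_cvg _ _ _ _ _ f (fun t : R => t `^ p)) fa.
  apply/differentiable_continuous/derivable1_diffP.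
  by apply: derivable_powR; rewrite in_itv/= a0.
have aE : a = 0.
  apply/eqP; rewrite eq_le a0 /= -(cvg_lim _ fa)//.
  by apply: limr_ge; [exact: cvgP fa|exact: nearW].
rewrite aE in fa *; rewrite powR0 ?gt_eqF//; apply/cvgr0Pnorm_le => e e0.
have e1 : 0 < e `^ p^-1 by rewrite powR_gt0.
apply: filterS (cvgr0_norm_le _ fa _ e1) => i; rewrite !ger0_norm ?powR_ge0// => fe.
have <- : (e `^ p^-1) `^ p = e by rewrite -powRrM mulVf ?gt_eqF// powRr1// ltW.
by apply: ge0_ler_powR; rewrite ?nnegrE ?powR_ge0// ltW.
Qed.

Lemma limn_einf_EFin (R : realType) (v : nat -> R) (a : R) :
  v k @[k --> \oo] --> a -> limn_einf (fun k => (v k)%:E) = a%:E.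
Proof.
move=> va.
have vaE : (v k)%:E @[k --> \oo] --> a%:E.
  by apply: cvg_EFin => //; exact: nearW.
by have [-> _] := cvg_limn_einf_sup vaE.
Qed.

Section WeakLimitGeometry.
Context {R : realType} {X : completeNormedModType R} (p c : R).
Hypotheses (p1 : 1 < p) (c0 : 0 < c) (pc : p_convexity_constant X p c).
Hypothesis opialX : Opial_property X.
Context (U : set_system nat) (u : nat -> X) (M : R) (z : X).
Hypotheses (UU : UltraFilter U) (uM : forall n, `|u n| <= M) (uz : weak_limit U u z).

Lemma norm_sub_cvg y : cvg (`|u n - y| @[n --> U]).
Proof.
apply: (@ultra_bounded_cvg R _ _ _ (M + `|y|)) => n.
by rewrite normr_id (le_trans (ler_normB _ _))// lerD2r.
Qed.

Local Notation r y := (lim (`|u n - y| @[n --> U])).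

Lemma norm_sub_near y (s : seq nat) :
  U [set n | `| `|u n - y| - r y| < (size s).+1%:R^-1].
Proof. exact: (cvgr_distC_lt _ _ (norm_sub_cvg y)). Qed.

(** Extract a sequence converging weakly to [z] along which both distances tend to their limits
    along [U]; these are then the lower limits in the Opial property. *)
Lemma Opial_weak_limit y : r z <= r y.
Proof.
have [->//|/eqP yz] := eqVneq y z.
have [phi [wphi Qphi]] := weakly_cvg_subsequence p c p1 c0 pc U u M z
  (fun s n => `| `|u n - z| - r z| < (size s).+1%:R^-1 /\
              `| `|u n - y| - r y| < (size s).+1%:R^-1)
  UU uM uz (fun s => filterI (norm_sub_near z s) (norm_sub_near y s)).
have := opialX _ _ _ wphi yz.
rewrite (@limn_einf_EFin _ (fun n => `|(u \o phi) n - z|) (r z)); last first.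
  by apply: cvg_harmonic_dist => k; have [+ _] := Qphi k; rewrite size_mkseq.
rewrite (@limn_einf_EFin _ (fun n => `|(u \o phi) n - y|) (r y)); last first.
  by apply: cvg_harmonic_dist => k; have [_ +] := Qphi k; rewrite size_mkseq.
by rewrite lte_fin => /ltW.
Qed.

(* Apply the convexity inequality at l z + (1 - l) y, divide by 1 - l, and let
   l tend to 1. *)
Lemma asymptotic_center_ineq y : r z `^ p + c * `|z - y| `^ p <= r y `^ p.
Proof.
have p0 : 0 < p by exact: lt_trans ltr01 p1.
have r0 x : 0 <= r x by apply: limr_ge; [exact: norm_sub_cvg|exact: nearW].
have rpow x : `|u n - x| `^ p @[n --> U] --> r x `^ p.
  by apply: powR_cvg => //; exact: norm_sub_cvg.
have seg (l : R) : 0 <= l < 1 ->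
    r z `^ p + l `^ p * (c * `|z - y| `^ p) <= r y `^ p.
  move=> /andP[l0 l1]; pose m := l *: z + (1 - l) *: y.
  pose B := l * r z `^ p + (1 - l) * r y `^ p - c * Wp p l * `|z - y| `^ p.
  have rm : r m `^ p <= B.
    apply: (@ler_cvg_to _ U _ _ (fun n => `|u n - m| `^ p)
      (fun n => l * `|u n - z| `^ p + (1 - l) * `|u n - y| `^ p - c * Wp p l * `|z - y| `^ p)).
    - exact: rpow.
    - apply: cvgB; last exact: cvg_cst.
      by apply: cvgD; apply: cvgMr; exact: rpow.
    - apply: nearW => n.
      have := pc (u n - z) (u n - y) l; rewrite l0 (ltW l1) => /(_ isT).
      rewrite (_ : l *: _ + _ = u n - m); last first.
        by rewrite !scalerBr addrACA -opprD -scalerDl [l + _]addrC subrK scale1r.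
      by rewrite (_ : u n - z - _ = y - z) ?(distrC y)// opprB addrC addrA subrK.
  have : r z `^ p <= B.
    apply: le_trans rm; apply: ge0_ler_powR; rewrite ?nnegrE ?(ltW p0)//.
    exact: Opial_weak_limit.
  rewrite /B /Wp => H.
  (* This summand of [Wp] is dropped; the remaining one carries the factor [1 - l] to be
     cancelled. *)
  have t0 : 0 <= l * (1 - l) `^ p * (c * `|z - y| `^ p).
    by rewrite !mulr_ge0 ?powR_ge0// ltW.
  have : (1 - l) * (r z `^ p + l `^ p * (c * `|z - y| `^ p)) <= (1 - l) * r y `^ p.
    nra.
  by rewrite ler_pM2l// subr_gt0.
(* Substituting the [p]-th root of [t] for [l] makes the inequality affine in [t]. *)
have segt (t : R) : 0 <= t < 1 -> r z `^ p + t * (c * `|z - y| `^ p) <= r y `^ p.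
  move=> /andP[t0 t1]; have := seg (t `^ p^-1).
  rewrite -powRrM mulVf ?gt_eqF// powRr1//; apply; rewrite powR_ge0/=.
  have := @gt0_ltr_powR R p^-1 _ t 1; rewrite powR1; apply; rewrite ?nnegrE//.
  by rewrite invr_gt0.
have d0 : 0 <= c * `|z - y| `^ p by rewrite mulr_ge0 ?powR_ge0// ltW.
move: (c * `|z - y| `^ p) d0 segt => d d0 segt.
rewrite leNgt; apply/negP => gap; pose g := r z `^ p + d - r y `^ p.
have h0 := segt 0 ltac:(by rewrite lexx ltr01).
have g0 : 0 < g by rewrite /g; lra.
have d00 : 0 < d by lra.
(* At this parameter the inequality reads [g <= g / 2]; the case [t = 0] gave [g <= d], so the
   parameter is admissible. *)
have t01 : 0 <= 1 - g / (2 * d) < 1.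
  have : g / (2 * d) <= 1 by rewrite ler_pdivrMr ?mulr_gt0// /g; lra.
  have : 0 < g / (2 * d) by rewrite divr_gt0 ?mulr_gt0//.
  lra.
have := segt _ t01; rewrite mulrBl mul1r.
have -> : g / (2 * d) * d = g / 2 by field; lra.
by rewrite /g; lra.
Qed.

Lemma WCS_weak_limit (w D : R) : 0 < w < WCS X ->
  (forall n, \forall m \near U, `|u m - u n| <= D) -> w * r z <= D.
Proof.
move=> /andP[w0 wW] uD.
have D0 : 0 <= D.
  have /filter_ex[m /= mD] : U [set m | `|u m - u 0%N| <= D] by exact: uD.
  exact: le_trans (normr_ge0 _) mD.
(* Each new term can be taken within [D] of the finitely many earlier ones, which bounds all mutual
   distances in the extracted sequence. *)
have allD (s : seq nat) : U [set n | forall m, m \in s -> `|u n - u m| <= D].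
  elim: s => [|k s IH]; first by apply: filterE => n m; rewrite in_nil.
  apply: filterS (filterI (uD k) IH) => n [nk ns] m; rewrite inE.
  by move=> /orP[/eqP->|/ns].
have [phi [wphi Qphi]] := weakly_cvg_subsequence p c p1 c0 pc U u M z
  (fun s n => `| `|u n - z| - r z| < (size s).+1%:R^-1 /\
              forall m, m \in s -> `|u n - u m| <= D)
  UU uM uz (fun s => filterI (norm_sub_near z s) (allD s)).
have rz : `|u (phi k) - z| @[k --> \oo] --> r z.
  by apply: cvg_harmonic_dist => k; have [+ _] := Qphi k; rewrite size_mkseq.
have phiD i j : `|u (phi i) - u (phi j)| <= D.
  wlog ij : i j / (j <= i)%N.
    by move=> H; have [/H//|/ltnW/H] := leqP j i; rewrite distrC.
  move: ij; rewrite leq_eqVlt => /orP[/eqP->|ij]; first by rewrite subrr normr0.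
  have [_] := Qphi i; apply; apply/mapP; exists j => //.
  by rewrite mem_iota.
have r0 : 0 <= r z by apply: limr_ge; [exact: norm_sub_cvg|exact: nearW].
(* Under the Schur property the extracted sequence converges in norm to [z], so [r z = 0]. *)
move: wW; rewrite /WCS; case: asboolP => [schurX _|_ wS].
  have /cvg_ex[l ul] := schurX _ _ wphi.
  have [f [fc _ fl]] := norming_functional (l - z).
  have lz : l = z.
    apply/eqP; rewrite -subr_eq0 -normr_eq0 -fl linearB subr_eq0; apply/eqP.
    have fl' : f (u (phi k)) @[k --> \oo] --> f l.
      by apply: (@continuous_cvg _ _ _ _ _ (u \o phi) f) => //; exact: fc.
    exact: (norm_cvg_unique fl' (wphi f fc)).
  suff -> : r z = 0 by rewrite mulr0.
  have r0' : `|u (phi k) - z| @[k --> \oo] --> (0 : R).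
    rewrite -lz -[0](normr0 X) -(subrr l); apply: cvg_norm.
    by apply: cvgB; [exact: ul|exact: cvg_cst].
  exact: (norm_cvg_unique rz r0').
set S := (X in sup X) in wS.
(* Otherwise [sup S] would be the default value 0, against [0 < w]. *)
have hS : has_sup S.
  by apply: contrapT => /sup_out S0; rewrite S0 in wS; lra.
have [w' Sw' ww'] := sup_adherent (eps := sup S - w) ltac:(by rewrite subr_gt0) hS.
rewrite opprB addrC subrK in ww'.
pose v k := u (phi k) - z.
have wv : weakly_cvg v 0.
  move=> f fc; rewrite linear0 -(subrr (f z)).
  rewrite (_ : (fun k => f (v k)) = (fun k => f (u (phi k)) - f z)); last first.
    by apply/funext => k; rewrite /v linearB.
  by apply: (@cvgB _ R^o); [exact: wphi|exact: cvg_cst].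
have rv : `|v k - 0| @[k --> \oo] --> r z by under eq_fun do rewrite subr0.
(* By the Opial property no point is asymptotically closer to [v] than its weak limit 0. *)
have radius : ((r z)%:E <= asymptotic_radius v)%E.
  apply: le_ereal_inf_tmp => _ [y _ <-].
  apply: le_trans (limn_einf_sup _).
  rewrite -(limn_einf_EFin _ _ _ rv).
  have [->//|/eqP y0] := eqVneq y 0.
  exact/ltW/opialX.
have diam : (asymptotic_diameter v <= D%:E)%E.
  apply: (@le_trans _ _ (ereal_sup [set `|(v ij.1 - v ij.2)%R|%:E |
      ij in [set ij : nat * nat | (0 <= ij.1)%N /\ (0 <= ij.2)%N]])).
    by apply: ereal_inf_lbound; exists 0%N.
  apply: ge_ereal_sup => _ [[i j] _ <-] /=.
  by rewrite lee_fin /v opprB addrA subrK phiD.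
have := Sw' _ wv => /le_trans /(_ diam) H.
have : (w'%:E * (r z)%:E <= D%:E)%E.
  apply: le_trans H; apply: lee_wpmul2l => //.
  by rewrite lee_fin ltW// (lt_trans w0).
rewrite -EFinM lee_fin; apply: le_trans.
by rewrite ler_wpM2r// ltW.
Qed.

End WeakLimitGeometry.

(** * Geometric iterations *)
Lemma expr_le_eps (R : realType) (g e : R) :
  0 <= g < 1 -> 0 < e -> exists n, g ^+ n <= e.
Proof.
move=> /andP[g0 g1] e0.
have gc : `|g| < 1 by rewrite ger0_norm.
have /filter_ex[n /=] : \forall n \near \oo, `|geometric 1 g n| <= e.
  exact: (cvgr0_norm_le _ (cvg_geometric 1 gc) _ e0).
rewrite mul1r normrX ger0_norm// => gn.
by exists n.
Qed.

Lemma cvg_geometric_increments (R : realType) (X : completeNormedModType R)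
    (v : nat -> X) (B g : R) :
  0 <= B -> 0 <= g < 1 -> (forall n, `|v n.+1 - v n| <= B * g ^+ n) ->
  exists l, forall n, `|l - v n| <= B / (1 - g) * g ^+ n.
Proof.
move=> B0 /andP[g0 g1] vB.
have g10 : 0 < 1 - g by rewrite subr_gt0.
have gn0 n : 0 <= B / (1 - g) * g ^+ n by rewrite mulr_ge0 ?exprn_ge0// divr_ge0// ltW.
(* The exact geometric partial sum is kept so that the induction closes. *)
have tele n j : `|v (n + j)%N - v n| <= B / (1 - g) * (g ^+ n - g ^+ (n + j)).
  elim: j => [|j IH]; first by rewrite addn0 !subrr normr0 mulr0.
  rewrite addnS -[v (n + j).+1](subrK (v (n + j)%N)) -addrA.
  rewrite (le_trans (ler_normD _ _))// (le_trans (lerD (vB _) IH))//.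
  rewrite exprS le_eqVlt; apply/orP; left; apply/eqP.
  by field; rewrite gt_eqF.
have tail n j : `|v (n + j)%N - v n| <= B / (1 - g) * g ^+ n.
  apply: le_trans (tele n j) _; rewrite ler_wpM2l ?divr_ge0 ?(ltW g10)//.
  by rewrite lerBlDr lerDl exprn_ge0.
have vc : cvgn v.
  apply: cauchy_cvg; apply: cauchy_exP => e e0.
  have d0 : 0 < e / 2 / (B / (1 - g) + 1).
    by rewrite !divr_gt0// ltr_wpDl// divr_ge0// ltW.
  have [n gn] := expr_le_eps _ _ _ (introT andP (conj g0 g1)) d0.
  exists (v n); exists n => // m /= nm; rewrite -ball_normE /= distrC.
  rewrite -(subnKC nm); apply: le_lt_trans (tail n (m - n)%N) _.
  apply: (@le_lt_trans _ _ (e / 2)); last by lra.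
  have B1 : 0 < B / (1 - g) + 1 by rewrite ltr_wpDl// divr_ge0// ltW.
  move: gn; rewrite ler_pdivlMr// => gn; apply: le_trans gn.
  by rewrite mulrC ler_wpM2l ?exprn_ge0// lerDl.
exists (limn v) => n.
have vn : `|v (n + j)%N - v n| @[j --> \oo] --> `|limn v - v n|.
  apply: cvg_norm; apply: cvgB; last exact: cvg_cst.
  exact: (cvg_comp (addn n) v (cvg_addnl n) vc).
rewrite -(cvg_lim _ vn)//; apply: limr_le; first exact: cvgP vn.
by apply: nearW => j; exact: tail.
Qed.

(* Optimising over n the bound by a g^n + L^n d gives the exponent
   alpha = ln g / ln (g / L), for which (g / L)^alpha = g. *)
Lemma Holder_interpolation (R : realType) (g L a M : R) :
  0 < g < 1 -> 1 < L -> 0 <= a -> 0 <= M ->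
  exists K alpha : R, [/\ 0 < K, 0 < alpha <= 1
    & forall q d : R, 0 <= d -> q <= M -> (forall n, q <= a * g ^+ n + L ^+ n * d) ->
        q <= K * d `^ alpha].
Proof.
move=> /andP[g0 g1] L1 a0 M0.
have L0 : 0 < L by exact: lt_trans L1.
have lg : ln g < 0 by rewrite ln_lt0// g0.
have lL : 0 < ln L by rewrite ln_gt0.
have gL0 : 0 < g / L by rewrite divr_gt0.
pose alpha := ln g / (ln g - ln L).
have glL : ln g - ln L < 0 by lra.
have alpha0 : 0 < alpha by rewrite /alpha -mulrNN -invrN divr_gt0 ?oppr_gt0.
have alpha1 : alpha <= 1.
  by rewrite /alpha -mulrNN -invrN ler_pdivrMr ?oppr_gt0//; lra.
have gLa : (g / L) `^ alpha = g.
  rewrite /powR gt_eqF// ln_div ?posrE// /alpha divfK ?lt_eqF//.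
  by rewrite lnK.
(* The first summand serves [d < 1], the second [1 <= d]. *)
pose K := (a + 1) / g + M.
have K1 : 0 < (a + 1) / g by rewrite divr_gt0// ltr_wpDl.
have K0 : 0 < K by rewrite /K ltr_pwDl.
exists K, alpha; split => //; first by rewrite alpha0.
move=> q d; rewrite le_eqVlt => /orP[/eqP <-|d0] qM qn.
  rewrite powR0 ?gt_eqF// mulr0; apply/ler_addgt0Pr => e e0; rewrite add0r.
  have a1 : 0 < a + 1 by rewrite ltr_wpDl.
  have [n gn] := expr_le_eps R g (e / (a + 1))
    ltac:(by rewrite (ltW g0)) ltac:(by rewrite divr_gt0).
  move: gn; rewrite ler_pdivlMr// => gn; have := qn n; rewrite mulr0 addr0 => /le_trans; apply.
  by apply: le_trans gn; rewrite mulrC ler_wpM2l ?exprn_ge0 ?lerDl// ltW.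
have [d1|d1] := leP 1 d.
  apply: (le_trans qM); apply: (@le_trans _ _ K); first by rewrite lerDr ltW.
  rewrite ler_peMr ?(ltW K0)//; have <- : 1 `^ alpha = 1 :> R by rewrite powR1.
  by apply: ge0_ler_powR; rewrite ?nnegrE ?(ltW alpha0) ?(ltW d0).
have gL1 : g / L < 1 by rewrite ltr_pdivrMr// mul1r (lt_trans g1).
have exn : exists n, (g / L) ^+ n <= d.
  by apply: expr_le_eps d0; rewrite (ltW gL0).
(* At [m], just before the first index with [(g / L) ^+ n <= d], both terms of the bound are of
   order [g ^+ m]; one step later [g ^+ m.+1] is below the [alpha]-th power of [d]. Index 0 is
   excluded by [d < 1]. *)
case: (ex_minnP exn) => -[|m] gLd nmin.
  by move: gLd; rewrite expr0 leNgt d1.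
have dm : d <= (g / L) ^+ m.
  by rewrite leNgt; apply/negP => /ltW /nmin; rewrite ltnn.
have gE n : g ^+ n = ((g / L) ^+ n) `^ alpha.
  rewrite -(@powR_mulrn R (g / L)) ?(ltW gL0)// -powRrM [n%:R * _]mulrC powRrM gLa.
  by rewrite powR_mulrn// ltW.
have Lm : L ^+ m * d <= g ^+ m.
  apply: (@le_trans _ _ (L ^+ m * (g / L) ^+ m)).
    by rewrite ler_wpM2l// exprn_ge0// ltW.
  by rewrite -exprMn mulrC divfK ?gt_eqF.
have da : g ^+ m.+1 <= d `^ alpha.
  by rewrite gE; apply: ge0_ler_powR; rewrite ?nnegrE ?exprn_ge0 ?(ltW alpha0) ?(ltW d0) ?(ltW gL0).
apply: (@le_trans _ _ ((a + 1) / g * g ^+ m.+1)).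
  rewrite exprS mulrA divfK ?gt_eqF// mulrDl mul1r.
  by apply: (le_trans (qn m)); rewrite lerD2l.
apply: (@le_trans _ _ ((a + 1) / g * d `^ alpha)).
  by rewrite ler_wpM2l// ltW.
by rewrite ler_wpM2r ?powR_ge0// lerDl.
Qed.

(** * Semigroups *)

Section SemigroupRetraction.
Context {R : realType} {X : completeNormedModType R} (p c : R).
Hypotheses (p1 : 1 < p) (c0 : 0 < c) (pc : p_convexity_constant X p c).
Hypothesis opialX : Opial_property X.
Context (C : set X) (M : R) (G : set R) (T : R -> X -> X).
Hypotheses (clC : closed C) (cvC : convex_set C) (CM : forall x, C x -> `|x| <= M).
Hypotheses (sgT : semigroup_on G C T) (arT : asymptotically_regular G C T).
Context (t : nat -> R) (k : R) (U : set_system nat).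
Hypotheses (Gt : forall n, G (t n)) (tG : t n @[n --> \oo] --> infty_in G).
Hypotheses (k1 : 1 <= k)
  (lipT : forall n x y, C x -> C y -> `|T (t n) x - T (t n) y| <= k * `|x - y|).
Hypotheses (UU : UltraFilter U) (ooU : \oo `<=` U).

Local Notation S n := (T (t n)).
Local Notation d x y := (lim (`|S n x - y| @[n --> U])).

Let k0 : 0 <= k. Proof. exact: le_trans k1. Qed.

Lemma semigroup_stable n x : C x -> C (S n x).
Proof. by move=> Cx; apply: sgT.1. Qed.

Lemma asymptotically_regular_near h x (e : R) : G h -> C x -> 0 < e ->
  \forall n \near U, `|T (t n + h) x - S n x| <= e.
Proof.
move=> Gh Cx e0; apply: ooU.
have := cvg_comp _ _ tG (arT x h Cx Gh) => /cvgr0_norm_le /(_ e e0).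
by apply: filterS => n; rewrite normr_id.
Qed.

Lemma orbit_bounded x : C x -> forall n, `|S n x| <= M.
Proof. by move=> Cx n; apply/CM/semigroup_stable. Qed.

Lemma orbit_dist_cvg x y : C x -> cvg (`|S n x - y| @[n --> U]).
Proof. by move=> Cx; apply: norm_sub_cvg => //; exact: orbit_bounded. Qed.

Lemma orbit_dist_le x y (b : R) : C x ->
  (forall e, 0 < e -> \forall n \near U, `|S n x - y| <= b + e) -> d x y <= b.
Proof.
move=> Cx H; apply/ler_addgt0Pr => e e0; apply: limr_le (H e e0).
exact: orbit_dist_cvg.
Qed.

Lemma orbit_dist_near x y (e : R) : C x -> 0 < e ->
  \forall n \near U, `|S n x - y| <= d x y + e.
Proof.
by move=> Cx e0; apply: (cvgr_le _ (orbit_dist_cvg x y Cx)); rewrite ltrDl.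
Qed.

Lemma orbit_dist_ge0 x y : C x -> 0 <= d x y.
Proof. by move=> Cx; apply: limr_ge; [exact: orbit_dist_cvg|exact: nearW]. Qed.

(** Asymptotic regularity allows replacing [S n x] by [S m (S n x)], to which the Lipschitz bound of
    [S m] applies. *)
Lemma orbit_dist_image m x y : C x -> C y -> d x (S m y) <= k * d x y.
Proof.
move=> Cx Cy; apply: orbit_dist_le => // e e0.
have e1 : 0 < e / (k + 1) by rewrite divr_gt0// ltr_wpDl.
have := asymptotically_regular_near _ _ _ (Gt m) Cx e1.
have := orbit_dist_near _ y _ Cx e1.
apply: filterS2 => n dn rn.
have Sxn : `|T (t n + t m) x - S m y| <= k * `|S n x - y|.
  by rewrite [t n + _]addrC sgT.2//; apply: lipT => //; exact: semigroup_stable.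
rewrite (_ : S n x - S m y = (S n x - T (t n + t m) x) + (T (t n + t m) x - S m y)); last first.
  by rewrite addrA subrK.
rewrite (le_trans (ler_normD _ _))// distrC; have := ler_wpM2l k0 dn; rewrite mulrDr => dn'.
have : e = e / (k + 1) * (k + 1) by rewrite divfK// gt_eqF// ltr_wpDl.
lra.
Qed.

(** The orbit tends along [U] to [x] and, by [orbit_dist_image], to every [S m x]; so all [S m] fix
    [x]. For other [h], not assumed to give continuous maps, [T h x = T (t n + h) x] is close to
    [S n x = x]. *)
Lemma fixed_point_criterion x : C x -> d x x = 0 -> Fix G C T x.
Proof.
move=> Cx dx; split=> // h Gh.
have Sx m : S m x = x.
  apply/eqP; rewrite -subr_eq0 -normr_le0 distrC.
  apply/ler_addgt0Pr => e e0; rewrite add0r.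
  have e1 : 0 < e / 2 by rewrite divr_gt0.
  have h1 := orbit_dist_near x (S m x) _ Cx e1.
  have h2 := orbit_dist_near x x _ Cx e1.
  have := orbit_dist_image m _ _ Cx Cx; rewrite dx mulr0 => h3.
  have /filter_ex[n [n1 n2]] : \forall n \near U,
      `|S n x - S m x| <= d x (S m x) + e / 2 /\ `|S n x - x| <= d x x + e / 2.
    exact: filterI.
  rewrite (_ : x - S m x = (x - S n x) + (S n x - S m x)); last by rewrite addrA subrK.
  rewrite (le_trans (ler_normD _ _))// distrC; rewrite dx in n2; lra.
apply/eqP; rewrite -subr_eq0 -normr_le0; apply/ler_addgt0Pr => e e0.
have /filter_ex[n] := asymptotically_regular_near _ _ _ Gh Cx e0.
by rewrite [t n + _]addrC sgT.2// Sx add0r.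
Qed.

Lemma Fix_orbit_dist x : Fix G C T x -> d x x = 0.
Proof.
move=> [Cx Tx]; rewrite (_ : (fun n => `|S n x - x|) = fun=> 0) ?lim_cst//.
by apply/funext => n; rewrite Tx// subrr normr0.
Qed.

Lemma orbit_dist_lipschitz x y : C x -> C y -> d x x <= d y y + (k + 1) * `|x - y|.
Proof.
move=> Cx Cy; apply: orbit_dist_le => // e e0.
apply: filterS (orbit_dist_near y y e Cy e0) => n yn.
rewrite (_ : S n x - x = (S n x - S n y) + (S n y - y) + (y - x)); last first.
  by rewrite !addrA !subrK.
rewrite (le_trans (ler_normD _ _))// (le_trans (lerD (ler_normD _ _) (lexx _)))//.
by have := lipT n x y Cx Cy; rewrite (distrC y); lra.
Qed.

Section Center.
Context (A : X -> X).
Hypothesis weakA : forall x, C x -> weak_limit U (fun n => S n x) (A x).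

Lemma center_stable x : C x -> C (A x).
Proof.
by move=> Cx; apply: weakA => //; apply: filterE => n; exact: semigroup_stable.
Qed.

(** A functional norming [A x - A y] takes values at most [k] times the distance of [x] and [y] on
    each [S n x - S n y]; pass to the limit. *)
Lemma center_lipschitz x y : C x -> C y -> `|A x - A y| <= k * `|x - y|.
Proof.
move=> Cx Cy; have [f [fc fn fA]] := norming_functional (A x - A y).
have fcvg z : C z -> f (S n z) @[n --> U] --> f (A z).
  move=> Cz; have fS : cvg (f (S n z) @[n --> U]).
    apply: (@ultra_bounded_cvg R _ _ _ M) => n.
    by apply: le_trans (fn _) _; exact: orbit_bounded.
  by rewrite (weak_limit_functional _ _ _ _ _ _ fc (weakA z Cz) fS).
have fB : (f (S n x) - f (S n y) : R) @[n --> U] --> (f (A x) - f (A y) : R).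
  by apply: (@cvgB _ R^o); exact: fcvg.
rewrite -fA linearB -(cvg_lim _ fB)//; apply: limr_le; first exact: cvgP fB.
apply: nearW => n; rewrite -linearB (le_trans (ler_norm _))//.
by rewrite (le_trans (fn _))// lipT.
Qed.

Lemma center_dist x : C x -> `|A x - x| <= d x x.
Proof.
move=> Cx; apply/ler_addgt0Pr => e e0.
exact: weak_limit_closed_ball (weakA x Cx) (orbit_dist_near x x e Cx e0).
Qed.

Lemma center_minimal x : C x -> d x (A x) <= d x x.
Proof.
move=> Cx; exact: (Opial_weak_limit p c p1 c0 pc opialX U (fun n => S n x) M
  (A x) UU (orbit_bounded x Cx) (weakA x Cx)).
Qed.

(** By [orbit_dist_image] with [y = x], the orbit is eventually within [k * d x x + e] of each of
    its own points. *)
Lemma center_WCS (w : R) x : 0 < w < WCS X -> C x -> w * d x (A x) <= k * d x x.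
Proof.
move=> w0 Cx; apply/ler_addgt0Pr => e e0.
apply: (WCS_weak_limit p c p1 c0 pc opialX U (fun n => S n x) M
  (A x) UU (orbit_bounded x Cx) (weakA x Cx) w _ w0) => n.
have := orbit_dist_near x (S n x) e Cx e0; apply: filterS => m /le_trans; apply.
by rewrite lerD2r orbit_dist_image.
Qed.

Lemma Fix_center x : Fix G C T x -> A x = x.
Proof.
move=> Fx; apply/eqP; rewrite -subr_eq0 -normr_le0.
by rewrite (le_trans (center_dist x Fx.1))// Fix_orbit_dist.
Qed.

(** The factor [b] unifies the two estimates of [d x (A x)]: 1 from minimality, [k / w] from
    [WCS]. *)
Lemma center_contracts (b : R) : 0 <= b ->
  (forall x, C x -> d x (A x) <= b * d x x) -> (k `^ p - 1) * b `^ p < c ->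
  exists2 g : R, 0 < g < 1 & forall x, C x -> d (A x) (A x) <= g * d x x.
Proof.
move=> b0 Ab kbc; have p0 : 0 < p by exact: lt_trans ltr01 p1.
have kp1 : 1 <= k `^ p.
  have <- : 1 `^ p = 1 :> R by rewrite powR1.
  by apply: ge0_ler_powR; rewrite ?nnegrE ?(ltW p0).
pose g0 := ((k `^ p - 1) * b `^ p / c) `^ p^-1.
have gp0 : 0 <= (k `^ p - 1) * b `^ p / c.
  by rewrite divr_ge0 ?(ltW c0)// mulr_ge0 ?powR_ge0// subr_ge0.
have g0p : g0 `^ p = (k `^ p - 1) * b `^ p / c.
  by rewrite /g0 -powRrM mulVf ?gt_eqF// powRr1.
have g01 : g0 < 1.
  rewrite ltNge; apply/negP => g1.
  have : 1 `^ p <= g0 `^ p by apply: ge0_ler_powR; rewrite ?nnegrE ?powR_ge0 ?(ltW p0).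
  by rewrite powR1 g0p ler_pdivlMr// mul1r leNgt kbc.
(* [g0] vanishes for [k = 1], whereas the Hölder exponent needs a positive rate. *)
exists (Num.max g0 2^-1).
  by rewrite lt_max gt_max g01; apply/andP; split; [apply/orP; right|]; lra.
move=> x Cx; have CA := center_stable x Cx; have d0 := orbit_dist_ge0 x x Cx.
suff SA m : `|S m (A x) - A x| <= g0 * d x x.
  apply: limr_le; first exact: orbit_dist_cvg.
  apply: nearW => m; apply: le_trans (SA m) _.
  by rewrite ler_wpM2r// le_max lexx.
have gd0 : 0 <= g0 * d x x by rewrite mulr_ge0 ?powR_ge0.
rewrite leNgt; apply/negP => SAgt.
have : (g0 * d x x) `^ p < `|S m (A x) - A x| `^ p.
  by apply: gt0_ltr_powR; rewrite ?nnegrE.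
have := asymptotic_center_ineq p c p1 c0 pc opialX U (fun n => S n x) M
  (A x) UU (orbit_bounded x Cx) (weakA x Cx) (S m (A x)).
have : d x (S m (A x)) `^ p <= k `^ p * d x (A x) `^ p.
  rewrite -powRM ?orbit_dist_ge0//; apply: ge0_ler_powR.
  - exact: ltW.
  - by rewrite nnegrE orbit_dist_ge0.
  - by rewrite nnegrE mulr_ge0 ?orbit_dist_ge0.
  - exact: orbit_dist_image.
have : d x (A x) `^ p <= b `^ p * d x x `^ p.
  rewrite -powRM//; apply: ge0_ler_powR; rewrite ?nnegrE ?mulr_ge0 ?orbit_dist_ge0 ?(ltW p0)//.
  exact: Ab.
rewrite powRM ?powR_ge0// g0p distrC.
move: (d x (S m (A x)) `^ p) (`|_| `^ p) (d x x `^ p) (d x (A x) `^ p) (b `^ p)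
  (k `^ p) kp1 => q1 q2 q3 q4 q5 q6.
move=> q61 q43 q14 q2q1.
rewrite mulrAC ltr_pdivrMr// => q3q2.
have := ler_wpM2l (_ : 0 <= q6 - 1) q43; rewrite subr_ge0 => /(_ q61).
lra.
Qed.

Lemma Holder_retract_of_contraction (g : R) : C !=set0 -> 0 < g < 1 ->
  (forall x, C x -> d (A x) (A x) <= g * d x x) ->
  (exists x, Fix G C T x) /\ Holder_retract C (Fix G C T).
Proof.
move=> [x0 Cx0] /andP[g0 g1] dA.
have M0 : 0 <= M by rewrite (le_trans _ (CM x0 Cx0)).
have g10 : 0 < 1 - g by rewrite subr_gt0.
pose it n x := iter n A x.
have Cit n x : C x -> C (it n x).
  by move=> Cx; elim: n => //= n; exact: center_stable.
have dM x : C x -> d x x <= 2 * M.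
  move=> Cx; apply: limr_le; first exact: orbit_dist_cvg.
  apply: nearW => n; apply: le_trans (ler_normB _ _) _.
  by have := orbit_bounded x Cx n; have := CM x Cx; lra.
have dit n x : C x -> d (it n x) (it n x) <= 2 * M * g ^+ n.
  move=> Cx; elim: n => [|n IH]; first by rewrite expr0 mulr1; exact: dM.
  apply: le_trans (dA _ (Cit n x Cx)) _.
  by rewrite exprS mulrCA ler_wpM2l// ltW.
have [r rP] : exists r : X -> X, forall x, C x ->
    forall n, `|r x - it n x| <= 2 * M / (1 - g) * g ^+ n.
  suff : forall x, exists y, C x -> forall n, `|y - it n x| <= 2 * M / (1 - g) * g ^+ n.
    by move=> /choice[r rP]; exists r.
  move=> x; have [Cx|nCx] := pselect (C x); last by exists x.
  have [|||y yP] := @cvg_geometric_increments R X (it ^~ x) (2 * M) g.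
  - by rewrite mulr_ge0.
  - by rewrite (ltW g0).
  - move=> n; apply: le_trans (dit n x Cx).
    exact: center_dist (Cit n x Cx).
  - by exists y.
pose B := 2 * M / (1 - g).
have B0 : 0 <= B by rewrite divr_ge0 ?mulr_ge0// ltW.
have itr x : C x -> it n x @[n --> \oo] --> r x.
  move=> Cx; apply/cvgrPdist_le => e e0.
  have B1 : 0 < B + 1 by rewrite ltr_wpDl.
  have [N gN] := expr_le_eps R g (e / (B + 1))
    ltac:(by rewrite (ltW g0)) ltac:(by rewrite divr_gt0).
  exists N => // n /= Nn; apply: le_trans (rP x Cx n) _.
  rewrite ler_pdivlMr// in gN; apply: le_trans gN; rewrite mulrDr mulr1 mulrC.
  rewrite -[leLHS]addr0 lerD ?exprn_ge0 ?(ltW g0)//.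
  by rewrite ler_wpM2r// ler_wiXn2l// ?(ltW g0) ?(ltW g1).
have Cr x : C x -> C (r x).
  move=> Cx; apply: (closed_cvg C clC _ _ (itr x Cx)).
  by apply: nearW => n; exact: Cit.
have Fr x : C x -> Fix G C T (r x).
  move=> Cx; apply: fixed_point_criterion; first exact: Cr.
  apply/eqP; rewrite eq_le orbit_dist_ge0 ?andbT; last exact: Cr.
  apply/ler_addgt0Pr => e e0; rewrite add0r.
  (* The decay of [d] at [it n x] and the distance from there to [r x] add up to at most
     [K * g ^+ n]; the final 1 makes [K] positive. *)
  pose K := 2 * M + (k + 1) * B + 1.
  have kB : 0 <= (k + 1) * B by rewrite mulr_ge0// addr_ge0.
  have K0 : 0 < K by rewrite /K; lra.
  have [n gn] := expr_le_eps R g (e / K)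
    ltac:(by rewrite (ltW g0)) ltac:(by rewrite divr_gt0).
  rewrite ler_pdivlMr// in gn; apply: le_trans gn.
  apply: le_trans (orbit_dist_lipschitz _ _ (Cr x Cx) (Cit n x Cx)) _.
  apply: le_trans (lerD (dit n x Cx) (ler_wpM2l _ (rP x Cx n))) _.
    by rewrite addr_ge0.
  have := exprn_ge0 n (ltW g0); rewrite /K -/B; nra.
have rF x : Fix G C T x -> r x = x.
  move=> Fx; have itx n : it n x = x.
    by elim: n => //= n ->; exact: Fix_center.
  have itxx : it n x @[n --> \oo] --> x by under eq_fun do rewrite itx; exact: cvg_cst.
  exact: (norm_cvg_unique (itr x Fx.1) itxx).
split; first by exists (r x0); exact: Fr.
split; first by move=> x [].
exists r; split=> //.
(* [k + 1] replaces [k], which may equal 1; [2 * B] comes from the two tails and [2 * M] bounds the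
   distance of two points of [C]. *)
have [||||K [alpha [K0 alpha01 Kal]]] := @Holder_interpolation R g (k + 1) (2 * B) (2 * M).
- by rewrite g0.
- by rewrite ltrDr (lt_le_trans ltr01 k1).
- by rewrite mulr_ge0.
- by rewrite mulr_ge0.
exists K, alpha; split=> // x y Cx Cy.
apply: Kal => //.
  apply: le_trans (ler_normB _ _) _.
  by have := CM _ (Cr x Cx); have := CM _ (Cr y Cy); lra.
move=> n.
have itL : `|it n x - it n y| <= (k + 1) ^+ n * `|x - y|.
  elim: n => [|n IH]; first by rewrite expr0 mul1r.
  apply: le_trans (center_lipschitz _ _ (Cit n x Cx) (Cit n y Cy)) _.
  rewrite exprS -mulrA; apply: ler_pM => //; last by rewrite lerDl.
rewrite (_ : r x - r y = (r x - it n x) + (it n x - it n y) + (it n y - r y)); last first.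
  by rewrite !addrA !subrK.
rewrite (le_trans (ler_normD _ _))// (le_trans (lerD (ler_normD _ _) (lexx _)))//.
have := rP x Cx n; have := rP y Cy n; rewrite (distrC (r y)) -/B; lra.
Qed.

End Center.

End SemigroupRetraction.

(** * Choice of the constants and conclusion *)

Lemma WCS_ge0 (R : realType) (X : completeNormedModType R) : 0 <= WCS X.
Proof.
rewrite /WCS; case: asboolP => // _; set S := (X in sup X).
have [hS|/sup_out ->//] := pselect (has_sup S).
apply: ub_le_sup; first by case: hS.
move=> u _; rewrite mul0e; apply: le_ereal_inf_tmp => _ [n _ <-].
apply: ereal_sup_ubound; exists (n, n) => //=.
by rewrite subrr normr0.
Qed.

(** The lower limit dominates the infimum over each tail of [G], so every tail contains an [s] whose
    exact constant is below [k]. *)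
Lemma lipschitz_subsequence (R : realType) (X : completeNormedModType R)
    (C : set X) (G : set R) (T : R -> X -> X) (k : R) :
  (limf_einf (fun t => lipschitz_const C (T t)) (infty_in G) < k%:E)%E ->
  exists t : nat -> R, [/\ forall n, G (t n), t n @[n --> \oo] --> infty_in G
    & forall n x y, C x -> C y -> `|T (t n) x - T (t n) y| <= k * `|x - y|].
Proof.
rewrite limf_einfE => Lk.
have late (n : nat) : exists s, [/\ G s, n%:R < s
    & forall x y, C x -> C y -> `|T s x - T s y| <= k * `|x - y|].
  have An : infty_in G [set s | G s /\ n%:R < s].
    exists n%:R; split; first exact: num_real.
    by move=> s ns Gs; split.
  have : (ereal_inf ((fun t => lipschitz_const C (T t)) @` [set s | G s /\ (n%:R < s)%R])
      < k%:E)%E.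
    apply: le_lt_trans Lk; apply: ereal_sup_ubound.
    by exists [set s | G s /\ n%:R < s].
  move=> /ereal_inf_lt[_ [s [Gs ns] <-]] /ereal_inf_lt[_ [j [j0 jlip] <-]].
  rewrite lte_fin => jk; exists s; split => // x y Cx Cy.
  have := jlip (x, y) (conj Cx Cy) => /= /le_trans; apply.
  by rewrite ler_wpM2r// ltW.
have [t tP] := choice late.
exists t; split => [n||n]; try by case: (tP n).
move=> B [a [_ aB]].
have [N aN] : exists N : nat, a < N%:R.
  by exists (Num.Def.archi_bound `|a|); rewrite (le_lt_trans (ler_norm a))// archi_boundP.
exists N => // n /= Nn; have [Gt nt _] := tP n.
by apply: aB => //; rewrite (lt_trans aN)// (le_lt_trans _ nt)// ler_nat.
Qed.

(** The lower limit may lie below 1; raising [k] to at least 1 keeps [k ^ p - 1] nonnegative. *)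
Lemma ereal_lt_EFin_between (R : realType) (L : \bar R) (b : R) : (L < b%:E)%E -> 1 < b ->
  exists k, [/\ 1 <= k, (L < k%:E)%E & k < b].
Proof.
case: L => [r| |] // Lb b1; last by exists 1; rewrite ltNyr.
exists (Num.max 1 ((r + b) / 2)); rewrite le_max lexx.
rewrite !lte_fin lt_max gt_max b1 /= in Lb *.
by split=> //; [apply/orP; right|]; lra.
Qed.

Lemma lt_powR_root (R : realType) (p a b : R) :
  0 < p -> 0 <= a -> 0 <= b -> a < b `^ p^-1 -> a `^ p < b.
Proof.
move=> p0 a0 b0 ab; have <- : (b `^ p^-1) `^ p = b.
  by rewrite -powRrM mulVf ?gt_eqF// powRr1.
by apply: gt0_ltr_powR; rewrite ?nnegrE ?powR_ge0.
Qed.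

Theorem theorem4p6 (R : realType) (X : completeNormedModType R) (p c : R)
    (C : set X) (G : set R) (T : R -> X -> X) :
  1 < p ->
  p_uniformly_convex X p ->
  Opial_property X ->
  C !=set0 -> bounded_set C -> closed C -> convex_set C ->
  0 < c -> p_convexity_constant X p c ->
  semigroup_index G ->
  semigroup_on G C T ->
  asymptotically_regular G C T ->
  (limf_einf (fun t => lipschitz_const C (T t)) (infty_in G) <
    (Num.max ((1 + c) `^ p^-1)
       ((2^-1 * (1 + (1 + 4 * c * WCS X `^ p) `^ 2^-1)) `^ p^-1))%:E)%E ->
  (exists x, Fix G C T x) /\ Holder_retract C (Fix G C T).
Proof.
move=> p1 _ opialX C0 bC clC cvC c0 pc _ sgT arT.
set b := Num.max _ _ => Lb.
have p0 : 0 < p by exact: lt_trans ltr01 p1.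
have b1 : 1 < b.
  rewrite /b lt_max; apply/orP; left.
  have : 1 `^ p^-1 < (1 + c) `^ p^-1.
    by apply: gt0_ltr_powR; rewrite ?invr_gt0 ?nnegrE//; lra.
  by rewrite powR1.
have [k [k1 Lk kb]] := ereal_lt_EFin_between _ _ _ Lb b1.
have k0 : 0 <= k by exact: le_trans k1.
have [t [Gt tG lipT]] := lipschitz_subsequence _ _ _ _ _ _ Lk.
have [M CM] : exists M : R, forall x, C x -> `|x| <= M.
  have /filter_ex[M CM] : \forall M \near +oo, forall x, C x -> `|x| <= M by exact: bC.
  by exists M.
have [U [UU ooU]] := @ultraFilterLemma nat \oo _.
have [A weakA] : exists A : X -> X, forall x, C x ->
    weak_limit U (fun n => T (t n) x) (A x).
  suff : forall x, exists z, C x -> weak_limit U (fun n => T (t n) x) z.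
    by move=> /choice[A weakA]; exists A.
  move=> x; have [Cx|nCx] := pselect (C x); last by exists x.
  have [|z xz] := weak_limit_exists p c M U (fun n => T (t n) x) p1 c0 pc _.
    by move=> n; apply/CM/sgT.1.
  by exists z.
pose d x y := lim (`|T (t n) x - y| @[n --> U]).
have [a [a0 dA kac]] : exists a : R, [/\ 0 <= a,
    forall x, C x -> d x (A x) <= a * d x x & (k `^ p - 1) * a `^ p < c].
  move: kb; rewrite /b lt_max => /orP[kb|kb].
    exists 1; split => //.
      move=> x Cx; rewrite mul1r.
      exact: (center_minimal p c p1 c0 pc opialX C M G T CM sgT t U Gt UU A weakA).
    rewrite powR1 mulr1.
    by have := lt_powR_root _ _ _ _ p0 k0 _ kb; rewrite addr_ge0 ?(ltW c0)// => /(_ isT); lra.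
  have W0 := @WCS_ge0 R X.
  have Wp0 : 0 <= WCS X `^ p by exact: powR_ge0.
  have cWp0 : 0 <= c * WCS X `^ p by rewrite mulr_ge0// ltW.
  have := lt_powR_root _ _ _ _ p0 k0 _ kb.
  have D0 : 0 <= 1 + 4 * c * WCS X `^ p by rewrite -mulrA; lra.
  rewrite powR12_sqrt// mulr_ge0 ?addr_ge0 ?sqrtr_ge0// => /(_ isT).
  have kp1 : 1 <= k `^ p.
    have <- : 1 `^ p = 1 :> R by rewrite powR1.
    by apply: ge0_ler_powR; rewrite ?nnegrE ?(ltW p0).
  set q := k `^ p in kp1 * => qlt.
  (* The second bound is the larger root of [q * (q - 1) = c * WCS ^ p]; square [2 * q - 1 < s]. *)
  have qc : q * (q - 1) < c * WCS X `^ p.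
    have := sqr_sqrtr D0; have := sqrtr_ge0 (1 + 4 * c * WCS X `^ p).
    move: (Num.sqrt _) qlt => s qlt s0 s2; rewrite -mulrA in s2.
    have : (2 * q - 1) ^+ 2 < s ^+ 2 by rewrite ltr_pXn2r ?nnegrE//; lra.
    rewrite s2; lra.
  have qq0 : 0 <= q * (q - 1) / c.
    by rewrite divr_ge0 ?(ltW c0)// mulr_ge0 ?subr_ge0// (le_trans ler01).
  (* [w0] is the value of [w] at which [(q - 1) * (k / w) ^ p] equals [c]; any [w] strictly between
     [w0] and [WCS X] will do. *)
  pose w0 := (q * (q - 1) / c) `^ p^-1.
  have w0p : w0 `^ p = q * (q - 1) / c.
    by rewrite /w0 -powRrM mulVf ?gt_eqF// powRr1.
  have w00 : 0 <= w0 by exact: powR_ge0.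
  have w0W : w0 < WCS X.
    rewrite ltNge; apply/negP => Ww0.
    have : WCS X `^ p <= w0 `^ p.
      by apply: ge0_ler_powR; rewrite ?nnegrE ?(ltW p0).
    by rewrite w0p ler_pdivlMr// mulrC leNgt qc.
  pose w := (w0 + WCS X) / 2.
  have w0w : w0 < w by rewrite /w; lra.
  have wpos : 0 < w by exact: le_lt_trans w0w.
  have wW : w < WCS X by rewrite /w; lra.
  exists (k / w); split.
  - by rewrite divr_ge0// ltW.
  - move=> x Cx; rewrite mulrAC ler_pdivlMr// mulrC.
    apply: (center_WCS p c p1 c0 pc opialX C M G T CM sgT arT
      t k U Gt tG k1 lipT UU ooU A weakA) => //.
    by rewrite wpos.
  - rewrite powRM ?invr_ge0 ?(ltW wpos)// -/q.
    have wi : (w^-1) `^ p = (w `^ p)^-1.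
      by rewrite -powR_inv1 ?(ltW wpos)// powRAC powR_inv1 ?powR_ge0.
    have : w0 `^ p < w `^ p by apply: gt0_ltr_powR; rewrite ?nnegrE ?(ltW wpos).
    rewrite w0p ltr_pdivrMr// wi mulrA ltr_pdivrMr ?powR_gt0//.
    by rewrite [q * _]mulrC [c * _]mulrC.
have [g g01 dg] := center_contracts p c p1 c0 pc opialX C M G T clC cvC CM sgT arT
  t k U Gt tG k1 lipT UU ooU A weakA a a0 dA kac.
exact: (Holder_retract_of_contraction C M G T clC cvC CM sgT arT t k U Gt tG k1 lipT
  UU ooU A weakA g C0 g01 dg).
Qed.
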